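(* Let $(G,f,\pi)$ be a monotone SDS on the vertex set $\{1,\dots,n\}$ with update schedule $\pi$. Then every state $X\in [S_{0,k}]_{\pi}\cup [S_{1,k}]_{\pi}$, for some $k$ with $1\le k\le n$, is either a Garden-of-Eden state or reaches a fixed point of $F_\pi$.
   Context: Let $G$ be a simple graph with vertex set $\{1,\dots,n\}$. Each vertex has a state in $\mathbb{F}_2=\{0,1\}$; a state of the system is $X=[x_1,\dots,x_n]\in\mathbb{F}_2^n$. Each vertex $i$ has a local function $f_i$ whose arguments are the states of $i$ and its neighbours in $G$. The inflation $F_i:\mathbb{F}_2^n\to\mathbb{F}_2^n$ replaces the $i$-th coordinate of $X$ by the value of $f_i$ on the current states of $i$ and its neighbours and leaves all other coordinates unchanged. An update schedule is a permutation $\pi=\pi_1\pi_2\cdots\pi_n$ of the vertices, and $F_\pi=F_{\pi_n}\circ\cdots\circ F_{\pi_1}$; the triple $(G,f,\pi)$ (with $f=(f_i)_i$) is a sequential dynamical system (SDS). Order $\mathbb{F}_2^n$ componentwise with $0<1$. A function $g:\mathbb{F}_2^q\to\mathbb{F}_2$ is monotone if $X\le Y$ implies $g(X)\le g(Y)$; the SDS is monotone if every $f_i$ is monotone. A state $X$ is a Garden-of-Eden (GoE) state if there is no $Y$ with $F_\pi(Y)=X$; $X$ is a fixed point if $F_\pi(X)=X$; $X$ reaches a fixed point if $F_\pi^m(X)$ is a fixed point for some $m\ge0$. Two update schedules $\pi,\pi'$ satisfy $\pi\sim_\alpha\pi'$ if there is $k$ such that $\pi'$ is obtained from $\pi$ by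 exchanging the entries in positions $k$ and $k+1$ (all other entries equal) and the vertices $\pi_k,\pi_{k+1}$ are not adjacent in $G$; $[\pi]_\alpha$ denotes the equivalence class of $\pi$ under the reflexive–transitive closure of $\sim_\alpha$. A schedule $\sigma=\sigma_1\cdots\sigma_n$ is regarded as the permutation $i\mapsto\sigma_i$ of $\{1,\dots,n\}$, acting on states by $\sigma\cdot X=[x_{\sigma^{-1}(1)},\dots,x_{\sigma^{-1}(n)}]$. Set $[X]_\pi=\{\sigma\cdot X:\sigma\in[\pi]_\alpha\}$. $S_{0,k}\in\mathbb{F}_2^n$ is the state with $x_i=0$ for $i\le k$ and $x_i=1$ for $i>k$; $S_{1,k}$ is the state with $x_i=1$ for $i\le k$ and $x_i=0$ for $i>k$. *)

(* Defs.v *)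
From HB Require Import structures.
From mathcomp Require Import all_boot all_order all_fingroup.

Set Implicit Arguments.
Unset Strict Implicit.
Unset Printing Implicit Defensive.

(* Vertices {1,...,n} and schedule positions are represented by 'I_n, hence
   numbered from 0; F_2 = {0,1} is bool with its canonical order
   false < true.  Only the order on F_2 is used, never its field structure. *)
Definition state (n : nat) := {ffun 'I_n -> bool}.

Definition simple_graph (n : nat) (e : rel 'I_n) : Prop :=
  symmetric e /\ irreflexive e.

Definition cnbhd (n : nat) (e : rel 'I_n) (i : 'I_n) : pred 'I_n :=
  fun j => (j == i) || e i j.

Definition local_state (n : nat) (e : rel 'I_n) (i : 'I_n) :=
  {ffun {j : 'I_n | cnbhd e i j} -> bool}.

Definition restrict (n : nat) (e : rel 'I_n) (i : 'I_n) (X : state n) :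
    local_state e i :=
  [ffun j => X (val j)].

Definition local_functions (n : nat) (e : rel 'I_n) :=
  forall i : 'I_n, local_state e i -> bool.

Definition monotone (T : finType) (g : {ffun T -> bool} -> bool) : Prop :=
  forall X Y : {ffun T -> bool},
    (forall t, (X t <= Y t)%O) -> (g X <= g Y)%O.

Definition monotone_SDS (n : nat) (e : rel 'I_n) (f : local_functions e) :
    Prop :=
  forall i, monotone (f i).

Definition inflation (n : nat) (e : rel 'I_n) (f : local_functions e)
    (i : 'I_n) (X : state n) : state n :=
  [ffun j => if j == i then f i (restrict e i X) else X j].

(* A schedule is the permutation mapping a position to the vertex updated at
   that position; position 0 is updated first. *)
Definition sds_map (n : nat) (e : rel 'I_n) (f : local_functions e)
    (pi : 'S_n) (X : state n) : state n :=
  foldl (fun Y i => inflation f i Y) X [seq pi k | k <- enum 'I_n].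

(* In MathComp, (s * t) x = t (s x), so tperm k l * pi is pi with the entries
   in positions k and l exchanged. *)
Definition alpha_step (n : nat) (e : rel 'I_n) : rel 'S_n :=
  fun pi pi' => [exists k : 'I_n, exists l : 'I_n,
    [&& l == k.+1 :> nat, ~~ e (pi k) (pi l) & pi' == (tperm k l * pi)%g]].

Definition alpha_class (n : nat) (e : rel 'I_n) (pi : 'S_n) : {set 'S_n} :=
  [set sigma | connect (alpha_step e) pi sigma].

Definition perm_state (n : nat) (sigma : 'S_n) (X : state n) : state n :=
  [ffun i => X ((sigma^-1)%g i)].

Definition state_class (n : nat) (e : rel 'I_n) (pi : 'S_n) (X : state n) :
    {set state n} :=
  [set perm_state sigma X | sigma in alpha_class e pi].

(* The vertex of 0-based index i has number i + 1, so "number <= k" reads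
   i < k. *)
Definition S0 (n k : nat) : state n := [ffun i : 'I_n => ~~ (i < k)].
Definition S1 (n k : nat) : state n := [ffun i : 'I_n => i < k].

Definition garden_of_eden (n : nat) (F : state n -> state n) (X : state n) :
    Prop :=
  ~ exists Y, F Y = X.

Definition fixed_point (n : nat) (F : state n -> state n) (X : state n) :
    Prop :=
  F X = X.

Definition reaches_fixed_point (n : nat) (F : state n -> state n)
    (X : state n) : Prop :=
  exists m : nat, fixed_point F (iter m F X).

(* Main.v *)
Require Import Defs.
From HB Require Import structures.
From mathcomp Require Import all_boot all_order all_fingroup.

(** Let X = F_pi Y with X = sigma . S, where sigma is alpha-equivalent to pi
    and S is constant, equal to b, on its first k positions and to [~~ b] on
    the others.  Along the schedule sigma, the computation of F X from X
    dominates, for the order whose least element is b, the computation of X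
    from Y: at the first k positions X takes the least value, and afterwards
    the entries of X not yet updated all have the greatest value.  Hence
    X <= F X for that order, and since F is monotone the orbit of X increases
    to a fixed point. *)

Set Implicit Arguments.
Unset Strict Implicit.
Unset Printing Implicit Defensive.

(* The order on [bool] with least element b: [x <= y] for [b = false] and
   [y <= x] for [b = true], so that S_{0,k} and S_{1,k} are treated at once. *)
Definition leb_from (b x y : bool) : bool := (x == b) || (y == ~~ b).

Definition state_le (T : Type) (b : bool) (X Y : T -> bool) : Prop :=
  forall t, leb_from b (X t) (Y t).

Lemma monotone_leb_from (T : finType) (g : {ffun T -> bool} -> bool) b
    (X Y : {ffun T -> bool}) :
  monotone g -> state_le b X Y -> leb_from b (g X) (g Y).
Proof.
move=> mono_g leXY; case: b leXY => leXY.
- have : (g Y <= g X)%O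
    by apply: mono_g => t; have := leXY t; case: (X t) (Y t) => [] [].
  by case: (g X) (g Y) => [] [].
- have : (g X <= g Y)%O
    by apply: mono_g => t; have := leXY t; case: (X t) (Y t) => [] [].
  by case: (g X) (g Y) => [] [].
Qed.

(** Monotonicity propagates [X <= F X] along the orbit, and each step that is not yet fixed strictly
    shrinks the set of coordinates equal to [b]. *)
Lemma increasing_reaches_fixed_point n (F : state n -> state n) b (X : state n) :
    (forall Y Z : state n, state_le b Y Z -> state_le b (F Y) (F Z)) ->
  state_le b X (F X) -> reaches_fixed_point F X.
Proof.
move=> mono_F; have [N] := ubnP #|[set i | X i == b]|.
elim: N X => // N IH X ltN leXF.
have [eqFX | neqFX] := eqVneq (F X) X; first by exists 0.
have [m fix_m] : reaches_fixed_point F (F X).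
  apply: IH (mono_F _ _ leXF); rewrite -ltnS; apply: leq_trans ltN.
  rewrite ltnS; apply: proper_card; apply/properP; split.
    apply/subsetP => i; rewrite !inE; have := leXF i.
    by move: (X i) (F X i); clear; case: b => [] [] [].
  have [i neq_i] : exists i, F X i != X i.
    apply/existsP; apply: contraNT neqFX; rewrite negb_exists => /forallP eqFX.
    by apply/eqP/ffunP => i; apply/eqP; have := eqFX i; rewrite negbK.
  exists i; rewrite !inE; have := leXF i; move: neq_i;
    by move: (X i) (F X i); clear; case: b => [] [] [].
by exists m.+1; rewrite /fixed_point iterSr.
Qed.

Section Schedules.

Variables (n : nat) (e : rel 'I_n) (f : local_functions e).

Lemma sds_map_homo b pi (X Y : state n) :
  monotone_SDS f -> state_le b X Y -> state_le b (sds_map f pi X) (sds_map f pi Y).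
Proof.
move=> mono_f; rewrite /sds_map; elim: [seq _ | _ <- _] X Y => //= i s IH X Y leXY.
apply: IH => j; rewrite !ffunE; case: eqP => // _.
by apply: monotone_leb_from => // t; rewrite !ffunE.
Qed.

(* What vertex i sees when its turn comes, for an initial state X and a final
   state Z: every vertex is updated exactly once, so an already updated vertex
   has its final value. *)
Definition view (pos : 'I_n -> nat) (X Z : state n) (i : 'I_n) : state n :=
  [ffun j => if pos j < pos i then Z j else X j].

(** Only the relative positions of adjacent vertices matter here, which makes these equations
    transferable along an alpha-class. *)
Definition update_equations (pos : 'I_n -> nat) (X Z : state n) : Prop :=
  forall i, Z i = f (restrict e i (view pos X Z i)).

Lemma foldl_inflation_notin s (X : state n) i :
  i \notin s -> foldl (fun Y j => inflation f j Y) X s i = X i.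
Proof.
elim: s X => //= a s IH X; rewrite inE negb_or => /andP[ia is_].
by rewrite IH // ffunE (negbTE ia).
Qed.

Lemma foldl_inflation_in s (X : state n) i : uniq s -> i \in s ->
  let Z := foldl (fun Y j => inflation f j Y) X s in
  Z i = f (restrict e i (view (index^~ s) X Z i)).
Proof.
elim: s X => //= a s IH X /andP[a_s uniq_s]; rewrite inE.
have Za : foldl (fun Y j => inflation f j Y) (inflation f a X) s a
          = f (restrict e a X).
  by rewrite foldl_inflation_notin // ffunE eqxx.
have [-> _ | ia /= i_s] := eqVneq i a.
  rewrite Za; congr (f (restrict e a _)); apply/ffunP => j.
  by rewrite ffunE eqxx ltn0.
rewrite IH //; congr (f (restrict e i _)); apply/ffunP => j.
rewrite !ffunE [a == i]eq_sym (negbTE ia) [a == j]eq_sym.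
(* [a] does not recur in [s], so its value after the first update is already final and both branches
   of the view agree. *)
have [-> | ja] := eqVneq j a; last by rewrite ltnS.
by rewrite ltn0Sn Za if_same.
Qed.

Lemma sds_map_update_equations (pi : 'S_n) (X : state n) :
  update_equations (fun i => (pi^-1)%g i) X (sds_map f pi X).
Proof.
move=> i; rewrite {1}/sds_map foldl_inflation_in; first last.
- by apply/mapP; exists ((pi^-1)%g i); rewrite ?mem_enum ?permKV.
- by rewrite map_inj_uniq ?enum_uniq //; apply: perm_inj.
congr (f (restrict e i _)); apply/ffunP => j; rewrite !ffunE.
have pos_index j' : index j' [seq pi k | k <- enum 'I_n] = (pi^-1)%g j'.
  rewrite -{1}(permKV pi j') index_map; last exact: perm_inj.
  exact: index_enum_ord.
by rewrite !pos_index.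
Qed.

(** Exchanging consecutive entries reverses the order of that one pair only, and its vertices are
    not adjacent. *)
Lemma alpha_step_pos (pi sigma : 'S_n) i j :
    symmetric e -> alpha_step e pi sigma -> cnbhd e i j ->
  ((sigma^-1)%g j < (sigma^-1)%g i) = ((pi^-1)%g j < (pi^-1)%g i).
Proof.
move=> sym_e /existsP[k /existsP[l /and3P[/eqP lE nadj /eqP ->]]].
case/predU1P => [-> | e_ij]; first by rewrite !ltnn.
rewrite !invMg tpermV !permM.
have [u iE] : exists u, i = pi u by exists ((pi^-1)%g i); rewrite permKV.
have [v jE] : exists v, j = pi v by exists ((pi^-1)%g j); rewrite permKV.
move: e_ij; rewrite iE jE !permK => e_uv.
case: tpermP => [vk | vl | /eqP vk /eqP vl];
  case: tpermP => [uk | ul | /eqP uk /eqP ul]; subst => //.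
- by rewrite !ltnn.
- by rewrite sym_e e_uv in nadj.
(* When exactly one of [u], [v] is exchanged, the other differs from both [k] and [k.+1], hence
   compares alike with the two. *)
- move: uk ul; rewrite -!val_eqE /= lE => uk ul.
  by rewrite [RHS]leq_eqVlt eq_sym (negbTE ul).
- by rewrite e_uv in nadj.
- by rewrite !ltnn.
- move: uk ul; rewrite -!val_eqE /= lE => uk ul.
  by rewrite [LHS]leq_eqVlt eq_sym (negbTE ul).
- move: vk vl; rewrite -!val_eqE /= lE => vk vl.
  by rewrite ltnS leq_eqVlt (negbTE vk).
- move: vk vl; rewrite -!val_eqE /= lE => vk vl.
  by rewrite ltnS [RHS]leq_eqVlt (negbTE vk).
Qed.

Lemma alpha_class_update_equations (pi sigma : 'S_n) (X Z : state n) :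
    symmetric e -> sigma \in alpha_class e pi ->
    update_equations (fun i => (pi^-1)%g i) X Z ->
  update_equations (fun i => (sigma^-1)%g i) X Z.
Proof.
move=> sym_e; rewrite inE => /connectP[s]; elim: s pi => [|rho s IH] pi /=.
  by move=> _ ->.
move=> /andP[step path_s] sigmaE eqs; apply: IH path_s sigmaE _ => i.
rewrite eqs; congr (f _); apply/ffunP => -[j ij].
by rewrite !ffunE /= (alpha_step_pos sym_e step ij).
Qed.

Lemma block_state_increasing b k (sigma : 'S_n) (S Y FX : state n) :
    monotone_SDS f -> (forall p : 'I_n, S p = if p < k then b else ~~ b) ->
    let X := perm_state sigma S in
    update_equations (fun i => (sigma^-1)%g i) Y X ->
    update_equations (fun i => (sigma^-1)%g i) X FX ->
  state_le b X FX.
Proof.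
move=> mono_f SE X eqX eqFX i.
have [N] := ubnP (val ((sigma^-1)%g i)); elim: N i => // N IH i ltN.
have [lt_k | ge_k] := ltnP ((sigma^-1)%g i) k.
  by rewrite /leb_from ffunE SE lt_k eqxx.
rewrite eqX eqFX; apply: monotone_leb_from => // -[j ij].
(* For [j] before [i] the views show [X j] and [FX j], compared by induction. Otherwise, [j = i]
   included, they show [Y j] and [X j], where [X j] is the greatest value. *)
rewrite !ffunE /=; case: ltnP => [lt_ji | le_ij].
  have := IH j; rewrite ffunE; apply.
  exact: leq_trans lt_ji ltN.
by rewrite SE ltnNge (leq_trans ge_k le_ij) /leb_from eqxx orbT.
Qed.

End Schedules.

Theorem theorem3p8 (n : nat) (e : rel 'I_n) (he : simple_graph e)
    (f : local_functions e) (hf : monotone_SDS f) (pi : 'S_n)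
    (k : nat) (hk : 1 <= k <= n) (X : state n)
    (hX : X \in state_class e pi (S0 n k) :|: state_class e pi (S1 n k)) :
  garden_of_eden (sds_map f pi) X \/ reaches_fixed_point (sds_map f pi) X.
Proof.
have [sym_e _] := he.
have [/existsP[Y /eqP FY] | noY] :=
  boolP [exists Y, sds_map f pi Y == X]; last first.
  by left => -[Y FY]; case/existsP: noY; exists Y; apply/eqP.
right.
have [b [S [sigma [sigma_pi SE XE]]]] : exists b (S : state n) sigma,
    [/\ sigma \in alpha_class e pi,
        forall p : 'I_n, S p = if p < k then b else ~~ b
      & X = perm_state sigma S].
  case/setUP: hX => /imsetP[sigma sigma_pi ->].
    by exists false, (S0 n k), sigma; split=> // p; rewrite ffunE; case: (p < k).
  by exists true, (S1 n k), sigma; split=> // p; rewrite ffunE; case: (p < k).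
apply: (@increasing_reaches_fixed_point _ _ b).
  by move=> Z W; apply: sds_map_homo.
have eqX := sds_map_update_equations f pi Y.
have eqFX := sds_map_update_equations f pi X.
(* Both runs, from [Y] to [X] and from [X] to its image, are reread along [sigma], where [X] has its
   block form. *)
rewrite FY in eqX; move: eqX eqFX => /(alpha_class_update_equations sym_e sigma_pi) eqX.
move=> /(alpha_class_update_equations sym_e sigma_pi) eqFX.
rewrite {1}XE; apply: (block_state_increasing hf SE (Y := Y));
  by rewrite -XE.
Qed.
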